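(* Let $(R,\mathfrak{m})$ be a finite commutative local ring with identity with residue field $\mathbb{F}_q$ of prime characteristic $p$. Let $k\in\mathbb{N}$ with $(k,p)=1$ and put $k'=(k,q-1)$, and assume that $\frac{q-1}{k'}\dagger q-1$. If $g(k,q)=2$, then $g_R(k)=2$ if $R$ is a field, and for $R$ not a field we have $$g_R(k)=\begin{cases}2, & \text{if } q \text{ is even, or else } q \text{ is odd and } k'\mid\tfrac{q-1}{2},\\ 3, & \text{if } q \text{ is odd and } k'\nmid\tfrac{q-1}{2}.\end{cases}$$
   Context: $(a,b)$ denotes the greatest common divisor. For a ring $A$, the Waring number $g_A(k)$ is the minimum $s\in\mathbb{N}$, if it exists, such that $x_1^k+\cdots+x_s^k=r$ has a solution in $A$ for every $r\in A$; $g(k,q)=g_{\mathbb{F}_q}(k)$. For $q=p^m$, $n\dagger q-1$ means that $n\mid p^m-1$ and $n\nmid p^a-1$ for all $1\le a<m$. *)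

(* Defs.v *)
From HB Require Import structures.
From mathcomp Require Import all_boot all_order all_algebra.

Set Implicit Arguments.
Unset Strict Implicit.
Unset Printing Implicit Defensive.

Import GRing.Theory.
Local Open Scope ring_scope.

Definition waring_solvable (A : nzRingType) (k s : nat) : Prop :=
  forall r : A, exists x : 'I_s -> A, \sum_(i < s) x i ^+ k = r.

(* The Waring number is only partially defined, so "g_A(k) = s" is a relation:
   it asserts that the minimum exists and equals s. *)
Definition is_waring_number (A : nzRingType) (k s : nat) : Prop :=
  waring_solvable A k s /\ (forall t : nat, waring_solvable A k t -> (s <= t)%N).

(* An [idealr] is proper by definition (it does not contain 1). *)
Definition maximal_ideal (R : comNzRingType) (m : idealr R) : Prop :=
  forall I : idealr R, {subset m <= I} -> I =i m.

Definition local_ring (R : comNzRingType) (m : idealr R) : Prop :=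
  maximal_ideal m /\ (forall n : idealr R, maximal_ideal n -> n =i m).

Definition residue_field (R : comNzRingType) (m : idealr R) (F : fieldType) :
    Prop :=
  exists f : {rmorphism {ideal_quot m} -> F}, bijective f.

(* [dagger p d n] is n "dagger" q - 1 for q = p ^ d. *)
Definition dagger (p d n : nat) : Prop :=
  (n %| (p ^ d - 1)%N)%N /\
  (forall a : nat, (1 <= a < d)%N -> ~~ (n %| (p ^ a - 1)%N)%N).

(* Main.v *)
Require Import Defs.
From HB Require Import structures.
From mathcomp Require Import all_boot all_order all_algebra.
From mathcomp Require Import cyclic finfield.

(** Let pi be the projection of R onto its residue field F; an element of R is
    a unit as soon as its image under pi is nonzero.

    Since k is prime to p, a k-th power in F other than 0 lifts: any r in R
    whose residue is a nonzero k-th power is a k-th power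
    ([kth_power_lift]).  Hence a representation pi r = a^k + b^k with a^k
    nonzero lifts to R: lift b arbitrarily to y, and r - y^k is a k-th power
    ([sum_two_lift]).  Every unit of R has such a representation, because at
    least one of the two summands of a nonzero sum is nonzero.  An element r of
    the maximal ideal has one exactly when 0 = a^k + b^k nontrivially in F,
    that is, when -1 is a k-th power in F; since the group of units of F is
    cyclic of order q - 1, for odd q this is the divisibility condition of the
    theorem, and for even q it holds because -1 = 1.  When R is a field the
    maximal ideal is zero, and 0 = 0^k + 0^k is enough.

    Suppose now that -1 is not a k-th power in F and R is not a field.  Three
    powers suffice, since r - 1 is a unit for r in the maximal ideal.  Two do
    not: if x^k + y^k is in the maximal ideal, then so are x and y, and as
    k > 1 the sum lies in the square of the maximal ideal.  As the ideal is
    nonzero, its square is strictly smaller, by Nakayama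
    ([maximal_ideal_not_decomposable]).

    Finally, the Waring number of R is at least that of its quotient F. *)

Import GRing.Theory.

(** * The projection of a finite local ring onto its residue field *)

Section LocalRings.

Local Open Scope ring_scope.

(** Finitely many proper ideals contain the multiples of [r], so one of them is
    maximal for inclusion. *)
Lemma nonunit_in_maximal_ideal (R : finComUnitRingType) (r : R) :
  r \notin GRing.unit -> exists n : idealr R, maximal_ideal n /\ r \in n.
Proof.
move=> nur.
pose ideal (S : {set R}) := [&& 0 \in S, 1 \notin S &
  [forall a, forall u in S, forall v in S, a * u + v \in S]].
have idealP (S : {set R}) : reflect (idealr_closed [in S]) (ideal S).
  apply: (iffP and3P) => [[S0 S1 /forallP hS]|[S0 S1 hS]]; split=> //.
    move=> a u v uS vS; move/forallP/(_ u)/implyP: (hS a) => /(_ uS).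
    by move/forallP/(_ v)/implyP/(_ vS).
  apply/forallP=> a; apply/forallP=> u; apply/implyP=> uS.
  by apply/forallP=> v; apply/implyP=> vS; apply: hS.
have: ideal [set a * r | a in R].
  apply/idealP; split.
  - by apply/imsetP; exists 0; rewrite ?mul0r.
  - apply/imsetP=> -[a _ ar1]; move/negP: nur; apply.
    by apply/unitrPr; exists a; rewrite mulrC -ar1.
  - move=> a _ _ /imsetP[b _ ->] /imsetP[c _ ->].
    by apply/imsetP; exists (a * b + c); rewrite // mulrDl mulrA.
case/maxset_exists=> M /maxsetP[/idealP idM maxM] /subsetP rM.
pose n : idealr R := HB.pack (fun x => x \in M) (isIdealr.Build R _ idM).
exists n; split; last by apply/rM/imsetP; exists 1; rewrite ?mul1r.
move=> I nI x; apply/idP/idP=> [xI|]; last exact: nI.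
change (x \in M).
suff <- : [set y in I] = M by rewrite inE.
apply: maxM; last by apply/subsetP=> y yM; rewrite inE nI.
apply/idealP; split; rewrite ?inE ?idealr0 ?idealr1 //.
by move=> a u v; rewrite !inE => uI vI; rewrite rpredD ?idealMr.
Qed.

Lemma local_ring_unit {R : finComUnitRingType} {m : idealr R} (r : R) :
  local_ring m -> r \notin m -> r \in GRing.unit.
Proof.
case=> _ uniq_m; apply: contraR => /nonunit_in_maximal_ideal[n [maxn rn]].
by rewrite -(uniq_m n maxn).
Qed.

(** All that the later arguments use of a local ring and its residue field: a
    surjective morphism to a field that detects units.  Its kernel is then the
    maximal ideal, so [pi r = 0] stands for membership in that ideal. *)
Lemma residue_map (R : finComUnitRingType) (m : idealr R) (F : fieldType) :
    local_ring m -> residue_field m F ->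
  exists pi : {rmorphism R -> F},
    (forall y, exists x, pi x = y) /\
    (forall r, pi r != 0 -> r \in GRing.unit).
Proof.
move=> locR [f [g fK gK]].
exists (f \o \pi_{ideal_quot m}%qT); split=> [y|r /= nz].
  by exists (repr (g y)); rewrite /= reprK gK.
apply: (local_ring_unit r locR); apply: contraNN nz => rm.
have -> : \pi_{ideal_quot m}%qT r = 0; last by rewrite rmorph0.
rewrite -(rmorph0 \pi_{ideal_quot m}%qT).
by apply/eqP; rewrite -Quotient.idealrBE subr0.
Qed.

End LocalRings.

(** * Lifting k-th powers from the residue field *)

Section Hensel.

Local Open Scope ring_scope.

Variables (R : finComUnitRingType) (F : fieldType) (pi : {rmorphism R -> F}).
Hypothesis pi_surj : forall y, exists x, pi x = y.
Hypothesis pi_unit : forall r, pi r != 0 -> r \in GRing.unit.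
Variable k : nat.
Hypothesis k_neq0 : k%:R != 0 :> F.

(** Hensel's lemma for X^k - t, by counting: on the finite set 1 + ker pi the
    map x |-> x^k is injective, hence onto.  Indeed x^k - y^k is the product of
    x - y with a sum of k monomials of residue 1, and that sum is a unit
    because its residue k is nonzero. *)
Lemma one_unit_is_kth_power (t : R) : pi t = 1 -> exists x : R, x ^+ k = t.
Proof.
move=> pit1; pose U := [set x : R | pi x == 1].
have inj : {in U &, injective (fun x => x ^+ k)}.
  move=> x y; rewrite !inE => /eqP x1 /eqP y1 /eqP.
  have us : \sum_(i < k) x ^+ (k.-1 - i) * y ^+ i \in GRing.unit.
    apply: pi_unit; rewrite rmorph_sum (eq_bigr (fun=> 1)) => [|i _].
      by rewrite sumr_const card_ord.
    by rewrite rmorphM !rmorphXn /= x1 y1 !expr1n mulr1.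
  by rewrite -subr_eq0 subrXX (mulIr_eq0 _ (mulIr us)) subr_eq0 => /eqP.
have sub : [set x ^+ k | x in U] \subset U.
  apply/subsetP=> _ /imsetP[x xU ->]; move: xU; rewrite !inE => /eqP x1.
  by rewrite rmorphXn /= x1 expr1n.
have /subset_cardP/(_ sub) eqU := card_in_imset inj.
have : t \in U by rewrite inE pit1.
by rewrite -eqU => /imsetP[x _ ->]; exists x.
Qed.

(** If u lifts a, then r / u^k has residue 1. *)
Lemma kth_power_lift (r : R) (a : F) :
  pi r = a ^+ k -> pi r != 0 -> exists x : R, x ^+ k = r.
Proof.
move=> ra nz; have [u pu] := pi_surj a.
have uu : u ^+ k \in GRing.unit by apply: pi_unit; rewrite rmorphXn /= pu -ra.
have [|x xk] := one_unit_is_kth_power (r / u ^+ k).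
  by rewrite rmorphM /= rmorphV // rmorphXn /= pu -ra divff.
by exists (x * u); rewrite exprMn xk divrK.
Qed.

Lemma sum_two_lift (r : R) (a b : F) :
  a ^+ k + b ^+ k = pi r -> a ^+ k != 0 ->
  exists x y : R, x ^+ k + y ^+ k = r.
Proof.
move=> ab nz; have [y py] := pi_surj b.
have eqa : pi (r - y ^+ k) = a ^+ k.
  by rewrite rmorphB /= rmorphXn /= py -ab addrK.
have [|x xk] := kth_power_lift (r - y ^+ k) a eqa; first by rewrite eqa.
by exists x, y; rewrite xk subrK.
Qed.

(** One of the two summands of the nonzero element pi r is nonzero. *)
Lemma unit_sum_two (r : R) :
    (forall y : F, exists a b, a ^+ k + b ^+ k = y) -> pi r != 0 ->
  exists x y : R, x ^+ k + y ^+ k = r.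
Proof.
move=> two nz; have [a [b ab]] := two (pi r).
have [a0|] := eqVneq (a ^+ k) 0; last exact: sum_two_lift ab.
apply: (sum_two_lift r b a); rewrite ?[b ^+ k + _]addrC //.
by move: nz; rewrite -ab a0 add0r.
Qed.

(** The representation 0 = c^k + 1^k has nonzero summands. *)
Lemma sum_two_of_root_m1 (r : R) (c : F) :
    c ^+ k = -1 -> pi r = 0 ->
  exists x y : R, x ^+ k + y ^+ k = r.
Proof.
move=> ck r0; apply: (sum_two_lift r c 1); first by rewrite ck expr1n r0 addNr.
by rewrite ck oppr_eq0 oner_eq0.
Qed.

(** If pi b were nonzero, -1 would be the k-th power of pi a / pi b. *)
Lemma kth_power_sum_in_ker (a b : R) :
    (forall c : F, c ^+ k != -1) -> pi (a ^+ k + b ^+ k) = 0 -> pi b = 0.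
Proof.
move=> noroot ab0; apply/eqP; apply: contraT => b0.
have /eqP[] := noroot (pi a / pi b).
move/eqP: ab0; rewrite rmorphD !rmorphXn /= addr_eq0 expr_div_n => /eqP->.
by rewrite mulNr divff ?expf_neq0.
Qed.

End Hensel.

(** * The square of the maximal ideal *)

Section Maximal.

Local Open Scope ring_scope.

Variables (R : finComUnitRingType) (F : fieldType) (pi : {rmorphism R -> F}).
Hypothesis pi_unit : forall r, pi r != 0 -> r \in GRing.unit.

(** Nakayama's argument on a minimal generating set S of the kernel M of [pi].
    If s in S were in M^2, then s = \sum_(t in S) e t * t with all e t in M;
    as 1 - e s is a unit, s would be a combination of the other generators.
    Sums of two products are the only elements of M^2 that matter for sums of
    two k-th powers, and restricting to them avoids defining M^2. *)
Lemma maximal_ideal_not_decomposable (r : R) :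
    r != 0 -> pi r = 0 ->
  exists2 s : R, pi s = 0 & forall x y x' y' : R,
    pi x = 0 -> pi y = 0 -> pi x' = 0 -> pi y' = 0 -> x * y + x' * y' != s.
Proof.
move=> r_neq0 pr; pose M := [set x : R | pi x == 0].
pose gen (S : {set R}) := (S \subset M) &&
  [forall x in M, exists c : {ffun R -> R}, x == \sum_(s in S) c s * s].
have: gen M.
  rewrite /gen subxx; apply/forallP=> x; apply/implyP=> xM; apply/existsP.
  exists [ffun y => (y == x)%:R]; rewrite (bigD1 x) //= ffunE eqxx mul1r.
  rewrite big1 ?addr0 // => y /andP[_ /negPf yx].
  by rewrite ffunE yx mul0r.
case/minset_exists=> S /minsetP[/andP[/subsetP SM /forallP genS] minS] _.
have {}genS x : pi x = 0 -> exists c : R -> R, x = \sum_(s in S) c s * s.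
  move=> px; have /implyP := genS x; rewrite inE px eqxx => /(_ isT).
  by case/existsP=> c /eqP->; exists c.
have [S0|[s sS]] := set_0Vmem S.
  have [c] := genS r pr; rewrite S0 big_set0 => r0.
  by rewrite r0 eqxx in r_neq0.
have ps : pi s = 0 by apply/eqP; have := SM s sS; rewrite inE.
exists s => // x y x' y' px py px' py'; apply/eqP=> eq_s.
have [c xE] := genS x px; have [c' xE'] := genS x' px'.
pose e t := c t * y + c' t * y'.
have sE : s = \sum_(t in S) e t * t.
  rewrite -[LHS]eq_s xE xE' !mulr_suml -big_split /=; apply: eq_bigr => t _.
  by rewrite mulrDl -!mulrA ![_ * t]mulrC.
have ue : 1 - e s \in GRing.unit.
  apply: pi_unit; rewrite rmorphB rmorphD !rmorphM /= py py' !mulr0 addr0.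
  by rewrite rmorph1 subr0 oner_neq0.
have sE' : s = \sum_(t in S :\ s) ((1 - e s)^-1 * e t) * t.
  apply: (mulrI ue); rewrite mulr_sumr mulrBl mul1r.
  transitivity (\sum_(t in S :\ s) e t * t).
    by apply/eqP; rewrite subr_eq {1}sE (big_setD1 s) //= addrC.
  by apply: eq_bigr => t _; rewrite mulrA mulVKr.
have gen' : gen (S :\ s).
  apply/andP; split.
    by apply/subsetP=> t /setD1P[_ /SM].
  apply/forallP=> z; apply/implyP; rewrite inE => /eqP pz; apply/existsP.
  have [d zE] := genS z pz.
  exists [ffun t => d s * ((1 - e s)^-1 * e t) + d t]; apply/eqP.
  rewrite {1}zE (big_setD1 s) //= {2}sE' mulr_sumr -big_split /=.
  by apply: eq_bigr => t _; rewrite ffunE mulrDl !mulrA.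
have := minS _ gen' (subsetDl _ _); move/setP/(_ s).
by rewrite !inE eqxx sS.
Qed.

End Maximal.

(** * When -1 is a k-th power in a finite field *)

Section MinusOne.

Local Open Scope ring_scope.

Lemma finField_prim_root (F : finFieldType) :
  exists z : F, #|F|.-1.-primitive_root z.
Proof.
have N0 : (0 < #|F|.-1)%N.
  by rewrite -card_finField_unit cardsT; apply/card_gt0P; exists 1%g.
have := @has_prim_root F _ (enum [pred x : F | x != 0]) N0.
case/(_ _ _ _)/hasP => [|||z _ pz]; last by exists z.
- apply/allP=> x; rewrite mem_enum inE unity_rootE => x0.
  rewrite -(inj_eq (mulfI x0)) -exprS prednK ?expf_card ?mulr1 //.
  by apply/card_gt0P; exists 0.
- exact: enum_uniq.
- by rewrite -cardE cardC1.
Qed.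

(** For a generator z of the units and g := gcd(k, q - 1), Bezout makes z^g a
    k-th power, and -1 = z^((q - 1) / 2) is a power of z^g. *)
Lemma root_m1_finField (F : finFieldType) (k : nat) :
    (0 < k)%N -> odd #|F| -> (gcdn k #|F|.-1 %| #|F|.-1 %/ 2)%N ->
  exists c : F, c ^+ k = -1.
Proof.
move=> k0 oddq /dvdnP[j half]; have [z pz] := finField_prim_root F.
have [evN N0] : (2 %| #|F|.-1)%N /\ (0 < #|F|.-1)%N.
  split; last exact: prim_order_gt0 pz.
  by move: oddq; rewrite dvdn2; case: #|F|.
have zhalf : z ^+ (#|F|.-1 %/ 2)%N = -1.
  apply/eqP; have := sqrf_eq1 (z ^+ (#|F|.-1 %/ 2)%N).
  rewrite -exprM divnK // (prim_expr_order pz) eqxx => /esym/orP[|//].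
  rewrite -(prim_order_dvd pz) => /dvdn_leq.
  by rewrite divn_gt0 // (dvdn_leq N0 evN) leqNgt ltn_Pdiv // => /(_ isT).
case: (egcdnP #|F|.-1 k0) => a b bez _; exists (z ^+ (a * j)).
rewrite -exprM mulnAC bez mulnDl exprD mulnAC exprM mulnC.
by rewrite -zhalf half exprAC (prim_expr_order pz) expr1n mul1r mulnC.
Qed.

(** If c^k = -1, then raising c to the power k (q - 1) / g, a multiple of q - 1,
    gives (-1)^((q - 1) / g) = 1, so that (q - 1) / g is even. *)
Lemma root_m1_finField_dvdn (F : finFieldType) (k : nat) (c : F) :
    odd #|F| -> -1 != 1 :> F -> c ^+ k = -1 ->
  (gcdn k #|F|.-1 %| #|F|.-1 %/ 2)%N.
Proof.
move=> oddq m1; set N := #|F|.-1; set g := gcdn k N => ck.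
have c0 : c != 0.
  apply: contraNneq m1 => c0; move: ck; rewrite c0 expr0n.
  by case: (k == 0)%N => [<- //|/esym/eqP]; rewrite oppr_eq0 oner_eq0.
have cN : c ^+ N = 1.
  apply: (mulfI c0); rewrite -exprS prednK ?expf_card ?mulr1 //.
  by apply/card_gt0P; exists 0.
have evN : (2 %| N)%N by move: oddq; rewrite dvdn2 /N; case: #|F|.
have [gk gN] : (g %| k)%N /\ (g %| N)%N by rewrite dvdn_gcdl dvdn_gcdr.
have : (-1) ^+ (N %/ g)%N = 1 :> F.
  by rewrite -ck -exprM muln_divCA_gcd exprM cN expr1n.
rewrite -signr_odd; case oddNg: (odd _).
  by move/eqP; rewrite expr1 (negPf m1).
move=> _; have e2 : (2 %| N %/ g)%N by rewrite dvdn2 oddNg.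
by rewrite -(divnK gN) -(divnK e2) mulnAC mulnK // dvdn_mull.
Qed.

End MinusOne.

(** * The Waring number *)

Theorem theorem7p1 (R : finComUnitRingType) (m : idealr R) (F : finFieldType)
    (p d q k : nat)
    (hlocal : local_ring m) (hF : residue_field m F)
    (hp : p \in [pchar F]%R) (hq : q = #|F|) (hqd : q = p ^ d)
    (hk : coprime k p)
    (hdagger : dagger p d ((q - 1) %/ gcdn k (q - 1)))
    (hg : is_waring_number F k 2) :
  (GRing.field_axiom R -> is_waring_number R k 2) /\
  (~ GRing.field_axiom R ->
     (~~ odd q \/ (odd q /\ gcdn k (q - 1) %| (q - 1) %/ 2) ->
        is_waring_number R k 2) /\
     (odd q /\ ~~ (gcdn k (q - 1) %| (q - 1) %/ 2) ->
        is_waring_number R k 3)).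
Proof.
have pr_p : prime p by case/andP: hp.
have k_gt0 : 0 < k.
  rewrite lt0n; apply: contraTneq hk => ->.
  by rewrite /coprime gcd0n gtn_eqF ?prime_gt1.
have kF : (k%:R != 0 :> F)%R.
  by rewrite -(dvdn_pcharf hp) -prime_coprime // coprime_sym.
have d_gt0 : 0 < d.
  rewrite lt0n; apply/eqP=> d0; have := card_finNzRing_gt1 F.
  by rewrite -hq hqd d0 expn0.
have odd_q : odd q = odd p by rewrite hqd oddX eqn0Ngt d_gt0.
have m1F : ((-1 == 1 :> F) = ~~ odd q)%R.
  rewrite odd_q eq_sym -subr_eq0 opprK -[(1 + 1)%R]/(2%:R)%R.
  rewrite -(dvdn_pcharf hp) dvdn_prime2 //.
  by apply/eqP/idP=> [->//|/(prime_oddPn pr_p)].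
have [pi [pi_surj pi_unit]] := residue_map R m F hlocal hF.
have two_F (y : F) : exists a b : F, (a ^+ k + b ^+ k = y)%R.
  have [x <-] := hg.1 y; exists (x ord0), (x (lift ord0 ord0)).
  by rewrite big_ord_recl big_ord_recl big_ord0 addr0.
(* A surjection carries representations over R to representations over F. *)
have geq2 t : waring_solvable R k t -> 2 <= t.
  move=> solR; apply: hg.2 => y; have [r <-] := pi_surj y.
  have [x <-] := solR r; exists (pi \o x).
  by rewrite rmorph_sum; apply: eq_bigr => i _; rewrite rmorphXn.
have unit_R := unit_sum_two R F pi pi_surj pi_unit k kF.
have solvable2 : (forall r : R, pi r = 0 ->
    exists x y : R, x ^+ k + y ^+ k = r)%R -> is_waring_number R k 2.
  move=> max_R; split=> // r.
  have [x [y <-]] : (exists x y : R, x ^+ k + y ^+ k = r)%R.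
    by have [/max_R|/unit_R] := eqVneq (pi r) 0%R; last apply.
  exists (fun i => if i == ord0 then x else y).
  by rewrite big_ord_recl big_ord_recl big_ord0 addr0.
split=> [fieldR|not_fieldR].
  (* The kernel of pi is then zero, and 0 = 0^k + 0^k. *)
  apply: solvable2 => r pr; exists 0%R, 0%R; rewrite expr0n gtn_eqF // addr0.
  have [->//|/fieldR/(rmorph_unit pi)] := eqVneq r 0%R.
  by rewrite pr unitr0.
split=> [root|[oddq noroot]].
  have [c ck] : exists c : F, (c ^+ k = -1)%R.
    case: root => [evq|[oddq]].
      by exists 1%R; rewrite expr1n; apply/eqP; rewrite eq_sym m1F.
    by rewrite hq subn1; apply: root_m1_finField; rewrite // -hq.
  by apply: solvable2 => r; apply: sum_two_of_root_m1 ck.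
have {}noroot (c : F) : (c ^+ k != -1)%R.
  apply: contraNneq noroot => ck; rewrite hq subn1.
  by apply: root_m1_finField_dvdn ck; rewrite -?hq // m1F oddq.
split=> [r|t solR].
  have [x [y [z <-]]] : (exists x y z : R, x ^+ k + (y ^+ k + z ^+ k) = r)%R.
    have [pr|/(unit_R _ two_F)[x [y <-]]] := eqVneq (pi r) 0%R.
      have [|y [z yz]] := unit_R (r - 1)%R two_F.
        by rewrite rmorphB rmorph1 pr sub0r oppr_eq0 oner_eq0.
      by exists 1%R, y, z; rewrite yz expr1n addrC subrK.
    by exists 0%R, x, y; rewrite expr0n gtn_eqF // add0r.
  exists (fun i => nth 0%R [:: x; y; z] i).
  by rewrite !big_ord_recl big_ord0 addr0.
(* For k = 1 the Waring number of F would be at most 1. *)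
have k_gt1 : 1 < k.
  rewrite ltn_neqAle k_gt0 andbT; apply/eqP=> k1.
  suff /hg.2 : waring_solvable F k 1 by [].
  by move=> y; exists (fun=> y); rewrite -k1 big_ord_recl big_ord0 addr0.
have [r r_neq0 pr] : exists2 r : R, (r != 0)%R & (pi r = 0)%R.
  case: (pickP [pred r | (r != 0)%R && (pi r == 0)%R]) => [r|none].
    by case/andP=> r0 /eqP pr; exists r.
  case: not_fieldR => r r0; apply: pi_unit.
  by have := none r; rewrite /= r0 => /negbT.
have [s ps s_indec] :=
  maximal_ideal_not_decomposable R F pi pi_unit r r_neq0 pr.
rewrite ltn_neqAle geq2 // andbT; apply/eqP=> t2.
move: solR; rewrite -t2 => /(_ s)[x].
rewrite big_ord_recl big_ord_recl big_ord0 addr0.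
set u := x _; set v := x _ => uv.
have pv : (pi v = 0)%R.
  by apply: (kth_power_sum_in_ker R F pi k u v noroot); rewrite uv.
have pu : (pi u = 0)%R.
  by apply: (kth_power_sum_in_ker R F pi k v u noroot); rewrite addrC uv.
have max_expr (a : R) : (pi a = 0 -> pi (a ^+ k.-1) = 0)%R.
  by move=> pa; rewrite rmorphXn /= pa expr0n -subn1 subn_eq0 leqNgt k_gt1.
have /eqP[] := s_indec u (u ^+ k.-1)%R v (v ^+ k.-1)%R
  pu (max_expr _ pu) pv (max_expr _ pv).
by rewrite -!exprS prednK.
Qed.
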